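(* Let $H=(kG)^*\#_\sigma^\tau kL$ be a cocentral abelian extension. Let $g\in G$, let $V$ be a simple $k_{\sigma_g}L_g$-module with character $\chi$, and let $\hat V$ be the corresponding simple $H$-module, with character $\hat\chi$. Then $$\nu_H(\hat\chi)=\frac{1}{|L|}\sum_{x\in T_g,\ z\in L_{g,g^{-1}}}\frac{\tau_{x\rightharpoonup g,\,x\rightharpoonup g^{-1}}(xzx^{-1})\,\sigma_{x\rightharpoonup g}(xzx^{-1},xzx^{-1})\,\sigma_{x\rightharpoonup g}(xz^2x^{-1},x)}{\sigma_{x\rightharpoonup g}(x,z^2)}\,\chi(z^2),$$ where $\chi(z^2)$ denotes the value of $\chi$ at the basis element $\widetilde{z^2}$ of $k_{\sigma_g}L_g$ (note $z^2\in L_g$ for $z\in L_{g,g^{-1}}$).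
   Context: $k$ is an algebraically closed field of characteristic not $2$; $G,L$ are finite groups with $\operatorname{char}k\nmid |G||L|$; $L$ acts on $G$ by group automorphisms, $(x,g)\mapsto x\rightharpoonup g$. Let $\{p_g\}_{g\in G}$ be the basis of $(kG)^*$ dual to $G$ (orthogonal idempotents). A cocentral abelian extension $H=(kG)^*\#_\sigma^\tau kL$ is a Hopf algebra over $k$ with basis $\{p_g\overline{x}: g\in G,x\in L\}$, unit $\sum_g p_g\overline 1$ and structure $$p_g\overline{x}\cdot p_h\overline{y}=\delta_{g,\,x\rightharpoonup h}\,\sigma_g(x,y)\,p_g\overline{xy},\qquad \Delta(p_g\overline{x})=\sum_{h\in G}\tau_{h,h^{-1}g}(x)\,p_h\overline{x}\otimes p_{h^{-1}g}\overline{x},\qquad \varepsilon(p_g\overline x)=\delta_{g,1},$$ for nonzero scalars $\sigma_g(x,y),\tau_{g,h}(x)\in k$ with $\sigma_g(1,x)=\sigma_g(x,1)=1$. Write $\overline x=\sum_g p_g\overline x$. Such $H$ and $H^*$ are semisimple. Schur indicator: let $\Lambda$ be the unique integral of $H$ with $\varepsilon(\Lambda)=1$ and $\Lambda^{[2]}=\sum\Lambda_1\Lambda_2$. For an $H$-module with character $\chi$, $\nu_H(\chi)=\chi(\Lambda^{[2]})$ (for simple modules this is $0$, $1$ or $-1$). Notation: $L_{g,h}=\{y\in L: y\rightharpoonup g=h\}$; $L_g=L_{g,g}$; $T_g$ is a complete set of left coset representatives of $L_g$ in $L$. The twisted group algebra $k_{\sigma_g}L_g$ has basis $\{\tilde x:x\in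 L_g\}$ with $\tilde x\tilde y=\sigma_g(x,y)\widetilde{xy}$. For a $k_{\sigma_g}L_g$-module $V$, $p_g\otimes V$ is a module over the subalgebra $(kG)^*\#_\sigma kL_g=\operatorname{span}\{p_h\overline x: h\in G,x\in L_g\}$ via $(p_h\overline x)\cdot(p_g\otimes v)=\delta_{h,g}(p_g\otimes\tilde x\cdot v)$, and $\hat V=H\otimes_{(kG)^*\#_\sigma kL_g}(p_g\otimes V)$. If $V$ is simple then $\hat V$ is a simple $H$-module. *)

(* Defs.v *)
From HB Require Import structures.
From mathcomp Require Import all_boot all_order all_algebra all_fingroup all_field.
From Stdlib Require Import ClassicalEpsilon.

Set Implicit Arguments.
Unset Strict Implicit.
Unset Printing Implicit Defensive.

Import GRing.Theory.
Local Open Scope ring_scope.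

Section TensorProduct.
Variable k : fieldType.

(* The tensor product of two finite dimensional spaces, as the space of
   coefficient matrices on the tensors of the basis vectors; [tlift f] is the
   linear map induced by a bilinear map [f] (see tlift_tens). *)
Definition tens (U V : vectType k) : vectType k :=
  'M[k]_(\dim {:U}, \dim {:V}).

Definition tens_elt (U V : vectType k) (u : U) (v : V) : tens U V :=
  \matrix_(i, j) (coord (vbasis {:U}) i u * coord (vbasis {:V}) j v).

Definition tlift (U V W : vectType k) (f : U -> V -> W) (t : tens U V) : W :=
  \sum_i \sum_j (t : 'M[k]_(_, _)) i j *: f (vbasis {:U})`_i (vbasis {:V})`_j.

Lemma tlift_tens (U V W : vectType k) (f : U -> V -> W) (u : U) (v : V) :
  (forall v, linear (f^~ v)) -> (forall u, linear (f u)) ->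
  tlift f (tens_elt u v) = f u v.
Proof.
move=> fl fr.
pose FL v := HB.pack_for {linear U -> W} (f^~ v)
  (GRing.isLinear.Build _ _ _ _ _ (fl v)).
pose FR u := HB.pack_for {linear V -> W} (f u)
  (GRing.isLinear.Build _ _ _ _ _ (fr u)).
rewrite {2}(coord_vbasis (memvf u)) -[RHS]/(FL v _) linear_sum /tlift.
apply: eq_bigr => i _; rewrite linearZ /= {2}(coord_vbasis (memvf v)).
rewrite -[f _ _ in RHS]/(FR _ _) linear_sum scaler_sumr.
by apply: eq_bigr => j _; rewrite mxE linearZ scalerA.
Qed.

End TensorProduct.

Notation "u '⊗' v" := (tens_elt u v) (at level 40, left associativity).

Section HopfAxioms.
Variables (k : fieldType) (H : falgType k).

Definition tens_mul (s t : tens H H) : tens H H :=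
  tlift (fun a b => tlift (fun c d => (a * c) ⊗ (b * d)) t) s.

Definition coassociative (Delta : H -> tens H H) : Prop :=
  forall h : H,
    tlift (fun a b => tlift (fun a1 a2 => a1 ⊗ (a2 ⊗ b)) (Delta a)) (Delta h)
  = tlift (fun a b => a ⊗ Delta b) (Delta h).

Definition counital (Delta : H -> tens H H) (eps : H -> k) : Prop :=
  forall h : H, tlift (fun a b => eps a *: b) (Delta h) = h
             /\ tlift (fun a b => eps b *: a) (Delta h) = h.

Definition antipode_axiom (Delta : H -> tens H H) (eps : H -> k) (S : H -> H) :=
  forall h : H, tlift (fun a b => S a * b) (Delta h) = (eps h)%:A
             /\ tlift (fun a b => a * S b) (Delta h) = (eps h)%:A.

End HopfAxioms.

HB.mixin Record Falgebra_isHopf (k : fieldType) H of Falgebra k H := {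
  comul : {linear H -> tens H H};
  counit : {lrmorphism H -> k^o};
  antipode : {linear H -> H};
  comul1 : comul 1 = 1 ⊗ 1;
  comulM : forall a b : H, comul (a * b) = tens_mul (comul a) (comul b);
  comulA : coassociative comul;
  comul_counit : counital comul counit;
  antipodeP : antipode_axiom comul counit antipode
}.

#[short(type="hopfAlgType")]
HB.structure Definition HopfAlgebra (k : fieldType) :=
  { H of Falgebra k H & Falgebra_isHopf k H }.

Section Modules.
Variables (k : fieldType).

(* A left module of dimension n over an algebra A is given by an algebra
   morphism rho : A -> 'M_n, with a acting on the column vector v as
   rho a *m v. *)
Definition simple_module (A : falgType k) n (rho : {lrmorphism A -> 'M[k]_n}) :=
  (0 < n)%N /\
  forall U : {vspace 'cV[k]_n},
    (forall (a : A) v, v \in U -> rho a *m v \in U) -> U = 0%VS \/ U = fullv.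

Definition module_char (A : falgType k) n (rho : {lrmorphism A -> 'M[k]_n})
  (a : A) : k := \tr (rho a).

(* The relations (hb)⊗v - h⊗(bv), b in B, of H ⊗_B V; by trilinearity it is
   enough to let h, b, v run over bases. Only the restriction of beta to the
   subalgebra B matters. *)
Definition balanced_rel (H : falgType k) (B : {vspace H}) n
    (beta : H -> 'M[k]_n) : {vspace tens H 'cV[k]_n} :=
  (\sum_(h <- vbasis {:H}) \sum_(b <- vbasis B)
     \sum_(v <- vbasis {:'cV[k]_n})
       <[ (h * b) ⊗ v - h ⊗ (beta b *m v) ]>)%VS.

(* rhoI is (a copy of) the H-module H ⊗_B V, the quotient of H ⊗ V by
   balanced_rel B beta, where V is k^n with b in B acting by beta b. *)
Definition is_induced_module (H : falgType k) (B : {vspace H}) n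
    (beta : H -> 'M[k]_n) m (rhoI : {lrmorphism H -> 'M[k]_m}) : Prop :=
  exists pi : 'Hom(tens H 'cV[k]_n, 'cV[k]_m),
    [/\ limg pi = fullv,
        lker pi = balanced_rel B beta
      & forall (a h : H) (v : 'cV[k]_n),
          pi ((a * h) ⊗ v) = rhoI a *m pi (h ⊗ v)].

End Modules.

Section SchurIndicator.
Variables (k : fieldType) (H : hopfAlgType k).

Definition normalized_integral (Lam : H) : Prop :=
  (forall h : H, h * Lam = (counit h : k) *: Lam
              /\ Lam * h = (counit h : k) *: Lam)
  /\ counit Lam = 1.

Lemma normalized_integral_unique (Lam Lam' : H) :
  normalized_integral Lam -> normalized_integral Lam' -> Lam = Lam'.
Proof.
move=> [intL eL] [intL' eL'].
have [_] := intL Lam'; rewrite eL' scale1r => <-.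
by have [-> _] := intL' Lam; rewrite eL scale1r.
Qed.

(* Definite description: the normalized integral is unique by the lemma above,
   and it exists when H is semisimple. *)
Definition integral1 : H := epsilon (inhabits 0) normalized_integral.

(* h^[2] = sum h_1 h_2 *)
Definition hopf_square (h : H) : H := tlift (fun a b => a * b) (comul h).

Definition schur_indicator (chi : H -> k) : k := chi (hopf_square integral1).

End SchurIndicator.

Record acts_by_automorphisms (L G : finGroupType) (act : L -> G -> G) : Prop := {
  act_one : forall g, act 1%g g = g;
  act_mul : forall x y g, act (x * y)%g g = act x (act y g);
  act_morph : forall x g h, act x (g * h)%g = (act x g * act x h)%g
}.

Section CocentralExtension.
Variables (k : fieldType) (G L : finGroupType) (act : L -> G -> G).

(* L_{g,h} *)
Definition transporter (g h : G) : {set L} := [set y | act y g == h].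

(* L_g *)
Definition stab (g : G) : {set L} := transporter g g.

Section Extension.
Variables (sigma : G -> L -> L -> k) (tau : G -> G -> L -> k).
Variables (H : hopfAlgType k) (p : G -> L -> H).

Definition ext_basis : #|{: G * L}|.-tuple H :=
  codom_tuple (fun u : G * L => p u.1 u.2).

(* H = (kG)^* #_sigma^tau kL, with p g x the basis element p_g \bar x *)
Record cocentral_extension : Prop := {
  ext_basisP : basis_of {:H} ext_basis;
  ext_sigma_neq0 : forall g x y, sigma g x y != 0;
  ext_tau_neq0 : forall g h x, tau g h x != 0;
  ext_sigma1x : forall g x, sigma g 1%g x = 1;
  ext_sigmax1 : forall g x, sigma g x 1%g = 1;
  ext_one : 1 = \sum_g p g 1%g;
  ext_mul : forall g h x y,
    p g x * p h y = if g == act x h then sigma g x y *: p g (x * y)%g else 0;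
  ext_comul : forall g x,
    comul (p g x)
    = \sum_h tau h (h^-1 * g)%g x *: (p h x ⊗ p (h^-1 * g)%g x);
  ext_counit : forall g x, counit (p g x) = (g == 1%g)%:R
}.

(* (kG)^* #_sigma kK *)
Definition ext_restr (K : {set L}) : {vspace H} :=
  <<[seq p h x | h <- enum G, x <- enum K]>>%VS.

End Extension.

(* A is (a copy of) the twisted group algebra k_{sigma_g} L_g, with e x the
   basis element \tilde x for x in L_g; the values of e outside L_g are
   irrelevant. *)
Definition is_twisted_group_algebra (sigma : G -> L -> L -> k) (g : G)
    (A : falgType k) (e : L -> A) : Prop :=
  basis_of {:A} [seq e x | x <- enum (stab g)]
  /\ {in stab g &, forall x y, e x * e y = sigma g x y *: e (x * y)%g}.

(* The action of (kG)^* #_sigma kL_g on p_g ⊗ V, V being the module rho: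
   the basis element p_h \bar x acts by rho (e x) if h = g and by 0 otherwise
   (see pg_actE). *)
Definition pg_act (H : hopfAlgType k) (p : G -> L -> H) (g : G)
    (A : falgType k) (e : L -> A) n (rho : A -> 'M[k]_n) (b : H) : 'M[k]_n :=
  \sum_(x in stab g) coord (ext_basis p) (enum_rank (g, x)) b *: rho (e x).

Lemma pg_actE sigma tau (H : hopfAlgType k) (p : G -> L -> H) (g : G)
    (A : falgType k) (e : L -> A) n (rho : A -> 'M[k]_n) h x :
  cocentral_extension sigma tau p -> x \in stab g ->
  pg_act p g e rho (p h x) = if h == g then rho (e x) else 0.
Proof.
move=> ext xg; have freeX := basis_free (ext_basisP ext).
have -> : p h x = (ext_basis p)`_(enum_rank (h, x)).
  by rewrite /= nth_codom enum_rankK.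
rewrite /pg_act (bigD1 x) //= big1 ?addr0 => [|y /andP[_ yx]].
  rewrite coord_free // (inj_eq enum_rank_inj) xpair_eqE eqxx andbT eq_sym.
  by case: eqP; rewrite ?scale1r ?scale0r.
rewrite coord_free // (inj_eq enum_rank_inj) xpair_eqE eq_sym.
rewrite [x == y]eq_sym (negbTE yx) andbF.
by rewrite scale0r.
Qed.

End CocentralExtension.

(* Main.v *)
(* The normalized integral is |L|^-1 sum_x p_1 x (the counit forces
   sigma_1 = 1), so its square is
   |L|^-1 sum_x sum_(h | x.h = h^-1) tau_{h,h^-1}(x) sigma_h(x,x) p_h (x^2).
   The induced module is the direct sum over t in T of copies p_{t.g} t ⊗ V
   of V. If y fixes h, then p_h y kills all of these except the one with
   t.g = h (if any), on which it acts as
   sigma_h(y,t) / sigma_h(t, t^-1 y t) times t^-1 y t. The formula follows by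
   taking y = x^2 and substituting x = t z t^-1. *)

Require Import Defs.
From HB Require Import structures.
From mathcomp Require Import all_boot all_order all_algebra all_fingroup all_field.
From Stdlib Require Import ClassicalEpsilon.

Set Implicit Arguments.
Unset Strict Implicit.
Unset Printing Implicit Defensive.

Import GRing.Theory.
Local Open Scope ring_scope.

(** * Vanishing on a basis, matrices of maps, traces and quotients *)

Section LinearAlgebra.
Variable k : fieldType.

Lemma linear_eq0_span (U W : vectType k) (X : seq U) (f : U -> W) :
  linear f -> {in X, forall x, f x = 0} -> {in <<X>>%VS, forall x, f x = 0}.
Proof.
move=> fl f0 x; pose F := HB.pack_for {linear U -> W} f
  (GRing.isLinear.Build _ _ _ _ _ fl).
have /span_subvP sX : {subset X <= lker (linfun F)}.
  by move=> y Xy; rewrite memv_ker lfunE /= f0.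
by move=> /(subvP sX); rewrite memv_ker lfunE /= => /eqP.
Qed.

Lemma linear_eq0_basis (U W : vectType k) (X : seq U) (f : U -> W) :
  basis_of {:U} X -> linear f -> {in X, forall x, f x = 0} -> forall x, f x = 0.
Proof.
move=> /span_basis bX fl f0 x.
by apply: (linear_eq0_span fl f0); rewrite bX memvf.
Qed.

Lemma linear_mx (m n : nat) (f : 'cV[k]_n -> 'cV[k]_m) :
  linear f -> exists M : 'M_(m, n), forall v, f v = M *m v.
Proof.
(* [lin1_mx] represents maps between row vectors, hence the two transposes. *)
move=> fl; pose ft (u : 'rV[k]_n) := (f u^T)^T.
have gl : linear ft by move=> a u v; rewrite /ft linearP fl linearP.
pose g := HB.pack_for {linear 'rV[k]_n -> 'rV[k]_m} ft
  (GRing.isLinear.Build _ _ _ _ _ gl).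
exists (lin1_mx g)^T => v; apply: trmx_inj.
by rewrite trmx_mul trmxK mul_rV_lin1 /= /ft trmxK.
Qed.

(* The hypotheses say that J is a monomorphism whose image contains that of M,
   and that M restricts to C on this image. *)
Lemma mxtrace_conj_left_inverse m n (M : 'M[k]_m) (J : 'M_(m, n))
    (J' : 'M_(n, m)) (C : 'M_n) :
  J' *m J = 1%:M -> M *m J = J *m C -> J *m J' *m M = M -> \tr M = \tr C.
Proof.
move=> J'J MJ <-; rewrite -mulmxA mxtrace_mulC -mulmxA MJ mulmxA.
by rewrite J'J mul1mx.
Qed.

Lemma memv_big_seq (W : vectType k) (I : eqType) (r : seq I)
    (F : I -> {vspace W}) i w :
  i \in r -> w \in F i -> w \in (\sum_(j <- r) F j)%VS.
Proof.
move=> ri Fw; rewrite (big_rem i ri) /=.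
exact: (subvP (addvSl _ _)).
Qed.

Lemma mulmx_cV_inj m n (M N : 'M[k]_(m, n)) :
  (forall v : 'cV_n, M *m v = N *m v) -> M = N.
Proof.
move=> MN; apply/matrixP=> i j.
by have /colP/(_ i) := MN (delta_mx j 0); rewrite -!colE !mxE.
Qed.

(** The linear right inverse [f^-1] sends [f u] to a vector that differs from [u] by an element of
    [lker f], and [g] kills that element. *)
Lemma hom_factor (U W W' : vectType k) (f : 'Hom(U, W)) (g : 'Hom(U, W')) :
  (lker f <= lker g)%VS -> exists r : 'Hom(W, W'), forall u, r (f u) = g u.
Proof.
move=> sfg; exists (g \o f^-1)%VF => u; rewrite comp_lfunE.
apply/eqP; rewrite -subr_eq0 -linearB -memv_ker; apply: (subvP sfg).
by rewrite memv_ker linearB /= limg_lfunVK ?memv_img ?memvf // subrr.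
Qed.

(** * Bilinearity of [⊗] and linear maps out of a tensor product *)

Section Tensors.
Variables U V : vectType k.

Lemma tens_linearl (v : V) : linear (fun u : U => u ⊗ v).
Proof.
by move=> a x y; apply/matrixP=> i j; rewrite !mxE linearP mulrDl mulrA.
Qed.

Lemma tens_linearr (u : U) : linear (fun v : V => u ⊗ v).
Proof.
by move=> a x y; apply/matrixP=> i j; rewrite !mxE linearP mulrDr mulrCA.
Qed.

Lemma tens_sum_basis (t : tens U V) :
  t = \sum_i \sum_j (t : 'M_(_, _)) i j *: ((vbasis {:U})`_i ⊗ (vbasis {:V})`_j).
Proof.
have fb (W : vectType k) := basis_free (vbasisP {:W}).
rewrite [LHS]matrix_sum_delta; apply: eq_bigr => i _; apply: eq_bigr => j _.
congr (_ *: _); apply/matrixP=> a b; rewrite !mxE !coord_free //.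
by rewrite -natrM mulnb [i == a]eq_sym [j == b]eq_sym.
Qed.

Lemma tlift_linear (W : vectType k) (f : U -> V -> W) : linear (tlift f).
Proof.
move=> a s t; rewrite /tlift scaler_sumr -big_split; apply: eq_bigr => i _ /=.
rewrite scaler_sumr -big_split; apply: eq_bigr => j _ /=.
by rewrite !mxE scalerDl scalerA.
Qed.

HB.instance Definition _ (W : vectType k) (f : U -> V -> W) :=
  GRing.isLinear.Build k (tens U V) W _ (tlift f) (tlift_linear f).

Lemma hom_tens_linearl (W : vectType k) (f : 'Hom(tens U V, W)) v :
  linear (fun u => f (u ⊗ v)).
Proof. by move=> a x y; rewrite tens_linearl linearP. Qed.

Lemma hom_tens_linearr (W : vectType k) (f : 'Hom(tens U V, W)) u :
  linear (fun v => f (u ⊗ v)).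
Proof. by move=> a x y; rewrite tens_linearr linearP. Qed.

Lemma hom_tensZl (W : vectType k) (f : 'Hom(tens U V, W)) a u v :
  f ((a *: u) ⊗ v) = a *: f (u ⊗ v).
Proof.
rewrite -linearZ; congr (f _); apply/matrixP=> i j.
by rewrite !mxE linearZ mulrA.
Qed.

Lemma hom_tensZr (W : vectType k) (f : 'Hom(tens U V, W)) a u v :
  f (u ⊗ (a *: v)) = a *: f (u ⊗ v).
Proof.
rewrite -linearZ; congr (f _); apply/matrixP=> i j.
by rewrite !mxE linearZ mulrCA.
Qed.

Lemma hom_tens_eq0 (W : vectType k) (X : seq U) (f : 'Hom(tens U V, W)) :
  basis_of {:U} X -> (forall x v, x \in X -> f (x ⊗ v) = 0) ->
  forall t, f t = 0.
Proof.
move=> bX f0 t; rewrite (tens_sum_basis t) linear_sum big1 // => i _.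
rewrite linear_sum big1 // => j _; rewrite linearZ /=.
rewrite (linear_eq0_basis bX (hom_tens_linearl f _)) ?scaler0 //.
by move=> x Xx; apply: f0.
Qed.

End Tensors.

(** * The relations that define [H ⊗_B V] *)

Section Balanced.
Variables (H : falgType k) (B : {vspace H}) (n : nat) (beta : H -> 'M[k]_n).
Variables (W : vectType k) (f : 'Hom(tens H 'cV[k]_n, W)).

Lemma balanced_subker :
  (forall h b v, b \in B -> f ((h * b) ⊗ v) = f (h ⊗ (beta b *m v))) ->
  (balanced_rel B beta <= lker f)%VS.
Proof.
move=> fB; rewrite /balanced_rel big_seq.
apply: (big_ind (fun X => X <= lker f)%VS) => [|X Y|h _].
- exact: sub0v.
- by rewrite subv_add => -> ->.
rewrite big_seq; apply: (big_ind (fun X => X <= lker f)%VS) => [|X Y|b].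
- exact: sub0v.
- by rewrite subv_add => -> ->.
move=> /vbasis_mem Bb; rewrite big_seq.
apply: (big_ind (fun X => X <= lker f)%VS) => [|X Y|v _].
- exact: sub0v.
- by rewrite subv_add => -> ->.
by rewrite -memvE memv_ker linearB /= fB // subrr.
Qed.

End Balanced.

(** [balanced_rel] is spanned by relations between basis vectors. Both sides are linear in [h], [b]
    and [v], so the variables are reduced to bases one at a time. *)
Lemma balanced_hom (H : falgType k) (B : {vspace H}) n (beta : H -> 'M[k]_n)
    (W : vectType k) (f : 'Hom(tens H 'cV[k]_n, W)) :
  linear beta -> (balanced_rel B beta <= lker f)%VS ->
  forall h b v, b \in B -> f ((h * b) ⊗ v) = f (h ⊗ (beta b *m v)).
Proof.
move=> lb sB h b v Bb; apply/eqP; rewrite -subr_eq0; apply/eqP; move: h.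
have lD (U : vectType k) (u1 u2 : U -> W) :
    linear u1 -> linear u2 -> linear (fun x => u1 x - u2 x).
  by move=> l1 l2 a x y; rewrite l1 l2 scalerBr addrACA opprD.
apply: (linear_eq0_basis (vbasisP _)).
  apply: lD; last exact: hom_tens_linearl.
  by move=> a x y; rewrite mulrDl -scalerAl hom_tens_linearl.
move=> h Hh; move: b Bb; rewrite -{1}(span_basis (vbasisP B)).
apply: linear_eq0_span.
  apply: lD => a x y; first by rewrite mulrDr -scalerAr hom_tens_linearl.
  by rewrite lb mulmxDl -scalemxAl hom_tens_linearr.
move=> b Bb; move: v; apply: (linear_eq0_basis (vbasisP _)).
  apply: lD => a x y; first by rewrite hom_tens_linearr.
  by rewrite mulmxDr -scalemxAr hom_tens_linearr.
move=> v Vv; apply/eqP; rewrite -linearB -memv_ker; apply: (subvP sB).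
apply: (memv_big_seq Hh); apply: (memv_big_seq Bb); apply: (memv_big_seq Vv).
exact: memv_line.
Qed.

End LinearAlgebra.

Section Extension.
Variables (k : fieldType) (G L : finGroupType) (act : L -> G -> G).
Hypothesis actP : acts_by_automorphisms act.
Variables (sigma : G -> L -> L -> k) (tau : G -> G -> L -> k).
Variables (H : hopfAlgType k) (p : G -> L -> H).
Hypothesis HP : cocentral_extension act sigma tau p.


(** * The action of [L] on [G] and its stabilizers *)

Lemma act_invK x : cancel (act x) (act x^-1%g).
Proof. by move=> h; rewrite -(Defs.act_mul actP) mulVg (act_one actP). Qed.

Lemma act_invKV x : cancel (act x^-1%g) (act x).
Proof. by move=> h; rewrite -(Defs.act_mul actP) mulgV (act_one actP). Qed.

Lemma act_g1 x : act x 1%g = 1%g.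
Proof.
by apply: (mulgI (act x 1%g)); rewrite -(Defs.act_morph actP) !mulg1.
Qed.

Lemma act_gV x h : act x h^-1%g = (act x h)^-1%g.
Proof.
by apply: (mulgI (act x h)); rewrite -(Defs.act_morph actP) !mulgV act_g1.
Qed.

Lemma act_inj x : injective (act x).
Proof. exact: can_inj (act_invK x). Qed.

Lemma stabP g x : reflect (act x g = g) (x \in stab act g).
Proof. by rewrite inE; apply: eqP. Qed.

Lemma stab1 g : 1%g \in stab act g.
Proof. by apply/stabP; rewrite (act_one actP). Qed.

(** Identifies left cosets of the stabilizer with points of the orbit of [g], so that [T] can be
    handled through the orbit. *)
Lemma mem_stab_act g x y :
  ((x^-1 * y)%g \in stab act g) = (act x g == act y g).
Proof.
rewrite inE (Defs.act_mul actP) -(inj_eq (@act_inj x)) act_invKV.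
by rewrite eq_sym.
Qed.

(** * Coset representatives as points of the orbit *)

Section Transversal.
Variables (g : G) (T : {set L}).
Hypothesis TP : is_transversal T (lcosets (stab act g) [set: L]) [set: L].

(** The block of the coset partition through [x] is [x *: stab act g], and [T] meets each block
    once. *)
Lemma transversal_card x : #|[set t in T | act x g == act t g]| = 1%N.
Proof.
case/and3P: TP => _ _ /forall_inP/(_ (x *: stab act g)%g) h.
rewrite -[RHS](eqP (h _)); last by apply/imsetP; exists x; rewrite ?inE ?lcosetE.
by apply: eq_card => t; rewrite !inE mem_lcoset mem_stab_act.
Qed.

Lemma transversal_exists x : exists2 t, t \in T & act x g = act t g.
Proof.
have /eqP/cards1P[t defT] := transversal_card x.
have : t \in [set t in T | act x g == act t g] by rewrite defT set11.
by rewrite inE => /andP[Tt /eqP]; exists t.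
Qed.

Lemma transversal_act_inj : {in T &, injective (act^~ g)}.
Proof.
move=> t u Tt Tu /= tu; have /eqP/cards1P[x defT] := transversal_card t.
have : t \in [set v in T | act t g == act v g] by rewrite inE Tt eqxx.
have : u \in [set v in T | act t g == act v g] by rewrite inE Tu tu eqxx.
by rewrite defT !inE => /eqP-> /eqP->.
Qed.

End Transversal.

(** * The normalized integral and its Hopf square *)

Lemma integral_normalized :
  #|L|%:R != 0 :> k ->
  normalized_integral (#|L|%:R^-1 *: \sum_x p 1%g x).
Proof.
move=> L0; have s1 x y : sigma 1%g x y = 1.
  have := ext_mul HP 1%g 1%g x y; rewrite act_g1 eqxx => /(congr1 counit).
  rewrite rmorphM linearZ /= !(ext_counit HP) eqxx mulr1.
  by rewrite /GRing.scale /= mulr1.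
split=> [h|]; last first.
  rewrite linearZ linear_sum /= (eq_bigr (fun=> 1)) => [|x _].
    by rewrite sumr_const; apply: mulVf.
  by rewrite (ext_counit HP) eqxx.
have lmul (x y : H) : linear (fun h => h * x - (counit h : k) *: y).
  move=> a u v; rewrite mulrDl -scalerAl linearP scalerDl -scalerA.
  by rewrite scalerBr opprD addrACA.
have lmur (x y : H) : linear (fun h => x * h - (counit h : k) *: y).
  move=> a u v; rewrite mulrDr -scalerAr linearP scalerDl -scalerA.
  by rewrite scalerBr opprD addrACA.
split; apply/eqP; rewrite -subr_eq0; apply/eqP; move: h.
  apply: (linear_eq0_basis (ext_basisP HP)); first exact: lmul.
  move=> _ /codomP[[g x] ->] /=.
  rewrite (ext_counit HP) -scalerAr mulr_sumr.
  (* A basis element [p g x] annihilates the sum unless [g = 1]; in that case it permutes the terms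
     by translation by [x]. *)
  rewrite (eq_bigr (fun y => if g == 1%g then p 1%g (x * y)%g else 0)) => [|y _].
    case: (eqVneq g 1%g) => [_|_]; last by rewrite big1 // scaler0 scale0r subr0.
    by rewrite scale1r [in X in _ - X](reindex_inj (mulgI x)) subrr.
  rewrite (ext_mul HP) act_g1; case: eqP => // ->.
  by rewrite s1 scale1r.
apply: (linear_eq0_basis (ext_basisP HP)); first exact: lmur.
move=> _ /codomP[[g x] ->] /=.
rewrite (ext_counit HP) -scalerAl mulr_suml.
rewrite (eq_bigr (fun y => if g == 1%g then p 1%g (y * x)%g else 0)) => [|y _].
  case: (eqVneq g 1%g) => [_|_]; last by rewrite big1 // scaler0 scale0r subr0.
  by rewrite scale1r [in X in _ - X](reindex_inj (mulIg x)) subrr.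
have y1 : (1%g == act y g) = (g == 1%g).
  by rewrite -(inj_eq (@act_inj y) g) act_g1 eq_sym.
rewrite (ext_mul HP) y1.
by rewrite s1 scale1r.
Qed.

(** Existence turns the choice made by [epsilon] into a normalized integral; uniqueness then
    identifies it. *)
Lemma integral1E :
  #|L|%:R != 0 :> k -> @Defs.integral1 k H = #|L|%:R^-1 *: \sum_x p 1%g x.
Proof.
move=> L0; apply: normalized_integral_unique (integral_normalized L0).
by apply: epsilon_spec; eexists; apply: integral_normalized.
Qed.

(** The coproduct of [p 1 x] pairs [p h x] with [p h^-1 x], and their product survives only if
    [h = act x h^-1], that is, if [x] inverts [h]. *)
Lemma hopf_square_pE x :
  hopf_square (p 1%g x) =
  \sum_(h | act x h == h^-1%g)
    (tau h h^-1%g x * sigma h x x) *: p h (x ^+ 2)%g.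
Proof.
have mull (v : H) : linear (fun u : H => u * v).
  by move=> a y z; rewrite mulrDl scalerAl.
have mulr (u : H) : linear (fun v : H => u * v).
  by move=> a y z; rewrite mulrDr scalerAr.
rewrite /hopf_square (ext_comul HP) linear_sum /=.
rewrite [RHS]big_mkcond; apply: eq_bigr => h _.
rewrite linearZ /= tlift_tens // (ext_mul HP) mulg1 act_gV.
rewrite -eq_invg_sym eq_sym.
by case: eqP; rewrite ?scaler0 // scalerA.
Qed.

Lemma hopf_square_integral1 :
  #|L|%:R != 0 :> k ->
  hopf_square (@Defs.integral1 k H) = #|L|%:R^-1 *:
    \sum_x \sum_(h | act x h == h^-1%g)
      (tau h h^-1%g x * sigma h x x) *: p h (x ^+ 2)%g.
Proof.
move=> L0; rewrite (integral1E L0) /hopf_square linearZ linear_sum /=.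
rewrite linearZ linear_sum /=; congr (_ *: _).
by apply: eq_bigr => x _; rewrite -hopf_square_pE.
Qed.

(** * The module [p_g ⊗ V] over the subalgebra *)

Section InducedModule.
Variables (g : G) (A : falgType k) (e : L -> A).
Hypothesis AP : is_twisted_group_algebra act sigma g e.
Variables (n : nat) (V : {lrmorphism A -> 'M[k]_n}).

(** The unit of [A] is not part of [is_twisted_group_algebra]; since [sigma g 1 x = 1], [e 1] is a
    left identity on the basis. *)
Lemma twisted_one : e 1%g = 1.
Proof.
have [bA eM] := AP; suff e1 a : e 1%g * a = a by rewrite -[LHS]mulr1 e1.
apply/eqP; rewrite -subr_eq0; apply/eqP; move: a; apply: (linear_eq0_basis bA).
  by move=> a x y; rewrite mulrDr -scalerAr scalerBr opprD addrACA.
move=> _ /mapP[x xg ->]; rewrite mem_enum in xg.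
by rewrite eM ?stab1 // (ext_sigma1x HP) scale1r mul1g subrr.
Qed.

Let beta := pg_act act p g e V.

Lemma pg_act_linear : linear beta.
Proof.
move=> a x y; rewrite /beta /pg_act scaler_sumr -big_split.
by apply: eq_bigr => z _ /=; rewrite linearP scalerDl scalerA.
Qed.

(** Extends [pg_actE] to all [x]: off the stabilizer [beta] is 0, so on [H] it is an extension by
    zero of the action of the subalgebra. *)
Lemma pg_act_pE h x :
  beta (p h x) = if (h == g) && (x \in stab act g) then V (e x) else 0.
Proof.
rewrite /beta; have [xg|xg] := boolP (x \in stab act g).
  by rewrite (pg_actE _ _ _ HP) // andbT.
rewrite andbF /pg_act big1 // => y yg.
have -> : p h x = (ext_basis p)`_(enum_rank (h, x)).
  by rewrite /= nth_codom enum_rankK.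
rewrite coord_free ?(basis_free (ext_basisP HP)) // (inj_eq enum_rank_inj).
rewrite xpair_eqE; case: (x =P y) xg => [->|_ _]; first by rewrite yg.
by rewrite andbF scale0r.
Qed.

(** On the subalgebra [beta] is the module action. It vanishes on the span of the [p f w] with [w]
    outside the stabilizer, and right multiplication by the subalgebra preserves that span. *)
Lemma pg_act_mul h b :
  b \in ext_restr p (stab act g) -> beta (h * b) = beta h *m beta b.
Proof.
have lB := pg_act_linear; move=> Bb; apply/eqP; rewrite -subr_eq0; apply/eqP.
move: h; apply: (linear_eq0_basis (ext_basisP HP)) => [a x y|].
  by rewrite mulrDl -scalerAl !lB mulmxDl -scalemxAl scalerBr opprD addrACA.
move=> _ /codomP[[f w] ->] /=; move: b Bb; apply: linear_eq0_span => [a x y|].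
  by rewrite mulrDr -scalerAr !lB mulmxDr -scalemxAr scalerBr opprD addrACA.
move=> _ /allpairsP[[h r] [_ /= rg ->]]; rewrite mem_enum in rg.
apply/eqP; rewrite subr_eq0; apply/eqP.
have b0 : beta 0 = 0 by have := lB (-1) 0 0; rewrite scaler0 addr0 scaleN1r addNr.
have bZ c u : beta (c *: u) = c *: beta u.
  by have := lB c u 0; rewrite b0 !addr0.
rewrite (ext_mul HP) (fun_if beta) b0 bZ !pg_act_pE rg andbT.
have -> : ((w * r)%g \in stab act g) = (w \in stab act g).
  by rewrite !inE (Defs.act_mul actP) (stabP _ _ rg).
have [wg|wg] := boolP (w \in stab act g); last first.
  by rewrite !andbF mul0mx scaler0 if_same.
rewrite !andbT; case: (eqVneq f g) => [->|_]; last first.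
  by rewrite scaler0 if_same mul0mx.
rewrite -{1}(stabP _ _ wg) (inj_eq (@act_inj w)) eq_sym.
case: eqP => [_|_]; last by rewrite mulmx0.
by rewrite -linearZ /= -(proj2 AP) // rmorphM.
Qed.

(** * The induced module as a quotient of [H ⊗ V], and its traces *)

Variables (m : nat) (hatV : {lrmorphism H -> 'M[k]_m}).
Variable pi : 'Hom(tens H 'cV[k]_n, 'cV[k]_m).
Hypothesis pi_surj : limg pi = fullv.
Hypothesis pi_ker : lker pi = balanced_rel (ext_restr p (stab act g)) beta.
Hypothesis pi_act : forall (a h : H) (v : 'cV[k]_n),
  pi ((a * h) ⊗ v) = hatV a *m pi (h ⊗ v).

Lemma mem_ext_restr h x :
  x \in stab act g -> p h x \in ext_restr p (stab act g).
Proof.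
by move=> xg; apply/memv_span/allpairs_f; rewrite mem_enum.
Qed.

Lemma pi_balanced h b v :
  b \in ext_restr p (stab act g) -> pi ((h * b) ⊗ v) = pi (h ⊗ (beta b *m v)).
Proof.
apply: (balanced_hom pg_act_linear); rewrite pi_ker; exact: subvv.
Qed.

(** Balancing over [p g s] expresses the vectors of a whole coset through its representative [t]. *)
Lemma pi_coset t s v :
  s \in stab act g ->
  sigma (act t g) t s *: pi (p (act t g) (t * s)%g ⊗ v) =
  pi (p (act t g) t ⊗ (V (e s) *m v)).
Proof.
move=> sg; have := pi_balanced (p (act t g) t) v (mem_ext_restr g sg).
rewrite (ext_mul HP) eqxx pg_act_pE eqxx sg /= => <-.
by rewrite hom_tensZl.
Qed.

(** [p f w] equals [p f w * p h 1] with [h = act w^-1 f], and [p h 1] acts on [V] by 0 when [h] is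
    not [g]. *)
Lemma pi_eq0 f w v : f != act w g -> pi (p f w ⊗ v) = 0.
Proof.
move=> nfw; set h := act w^-1%g f.
have hg : h != g by apply: contraNneq nfw => <-; rewrite act_invKV.
have := pi_balanced (p f w) v (mem_ext_restr h (stab1 g)).
rewrite (ext_mul HP) act_invKV eqxx (ext_sigmax1 HP) scale1r mulg1 => ->.
by rewrite pg_act_pE (negbTE hg) mul0mx -(scale0r 0) hom_tensZr scale0r.
Qed.

Lemma pi_mx_eq0 (N : 'M_m) :
  (forall f w v, N *m pi (p f w ⊗ v) = 0) -> N = 0.
Proof.
move=> N0; apply: mulmx_cV_inj => u; rewrite mul0mx.
have /memv_imgP[t _ ->] : u \in limg pi by rewrite pi_surj memvf.
pose Nl := linfun (mulmx N : 'cV_m -> 'cV_m).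
suff : (Nl \o pi)%VF t = 0 by rewrite comp_lfunE lfunE.
apply: (hom_tens_eq0 (ext_basisP HP)) => _ v /codomP[[f w] ->] /=.
by rewrite comp_lfunE lfunE; apply: N0.
Qed.

(* Left multiplication by p_g t^-1 carries the component of t to that of 1,
   which h ⊗ v |-> beta h *m v maps back to V; the latter is well defined on
   the quotient by pg_act_mul. *)
Lemma induced_component t : exists J : 'M_(m, n), exists2 J' : 'M_(n, m),
  J' *m J = 1%:M & forall v, J *m v = pi (p (act t g) t ⊗ v).
Proof.
have [J JE] := linear_mx (hom_tens_linearr pi (p (act t g) t)).
pose phi := linfun (tlift (fun (h : H) (v : 'cV[k]_n) => beta h *m v)).
have phiE h v : phi (h ⊗ v) = beta h *m v.
  rewrite lfunE /= tlift_tens // => [{}v|{}h] a x y.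
    by rewrite pg_act_linear mulmxDl scalemxAl.
  by rewrite mulmxDr scalemxAr.
have kphi : (lker pi <= lker phi)%VS.
  rewrite pi_ker; apply: balanced_subker => h b v Bb.
  by rewrite !phiE pg_act_mul // mulmxA.
have [psi psiE] := hom_factor kphi.
have [P PE] := linear_mx (linearP psi).
(* [c] is the scalar in [p g t^-1 * p (act t g) t = c *: p g 1]; dividing by it makes the map a left
   inverse of [J]. *)
pose c := sigma g t^-1%g t.
exists J, (c^-1 *: (P *m hatV (p g t^-1%g))) => [|v]; last by rewrite -JE.
apply: mulmx_cV_inj => v; rewrite -scalemxAl -scalemxAl -!mulmxA -JE -pi_act.
rewrite (ext_mul HP) act_invK eqxx mulVg -/c.
rewrite hom_tensZl -scalemxAr scalerA mulVf ?(ext_sigma_neq0 HP) // scale1r.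
rewrite -PE; apply: (etrans (psiE _)).
by rewrite phiE pg_act_pE eqxx stab1 twisted_one rmorph1.
Qed.

Variable T : {set L}.
Hypothesis TP : is_transversal T (lcosets (stab act g) [set: L]) [set: L].

(** The sum has at most one term. This form covers [h] outside the orbit of [g] and lets the sums
    over [h] and [T] be exchanged later. *)
Lemma trace_induced h y :
  act y h = h ->
  \tr (hatV (p h y)) =
  \sum_(t in T | h == act t g)
    sigma h y t / sigma h t (y ^ t)%g * \tr (V (e (y ^ t)%g)).
Proof.
move=> yh; have pi_p f w v : hatV (p h y) *m pi (p f w ⊗ v) =
    if h == act y f then sigma h y w *: pi (p h (y * w)%g ⊗ v) else 0.
  rewrite -pi_act (ext_mul HP); case: ifP => _; first by rewrite hom_tensZl.
  by rewrite -(scale0r 0) hom_tensZl scale0r.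
case: (pickP [pred t in T | h == act t g]) => [t /= /andP[Tt /eqP ht]|noT].
  rewrite (big_pred1 t) => [|u /=]; last first.
    apply/andP/eqP => [[Tu /eqP hu]|->]; last by rewrite Tt -ht.
    by apply: (transversal_act_inj TP) => //=; rewrite -hu.
  have [J [J' J'J JE]] := induced_component t; rewrite -ht in JE.
  have st : (y ^ t)%g \in stab act g.
    by rewrite conjgE mem_stab_act (Defs.act_mul actP) -ht yh.
  rewrite -mxtraceZ; apply: (mxtrace_conj_left_inverse J'J).
    (* Since [y * t = t * (y ^ t)], [pi_coset] moves [y ^ t] onto [V]. *)
    apply: mulmx_cV_inj => v.
    rewrite -!mulmxA -scalemxAl -scalemxAr !JE ht -pi_coset // -ht.
    rewrite pi_p yh eqxx scalerA mulfVK ?(ext_sigma_neq0 HP) //.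
    by rewrite conjgE !mulgA mulgV mul1g.
  apply/eqP; rewrite -subr_eq0; apply/eqP/pi_mx_eq0 => f w v.
  rewrite mulmxBl -!mulmxA pi_p; case: (h =P act y f) => _; last first.
    by rewrite !mulmx0 subrr.
  have [hw|] := eqVneq h (act (y * w)%g g); last first.
    by move/pi_eq0=> ->; rewrite scaler0 !mulmx0 subrr.
  (* Now [y * w] lies in the coset of [t], so by [pi_coset] the vector is in the image of [J], which
     [J *m J'] fixes. *)
  have sg : (t^-1 * (y * w))%g \in stab act g by rewrite mem_stab_act -ht -hw.
  have := pi_coset t v sg; rewrite -ht mulKVg -JE.
  move/(canRL (scalerK (ext_sigma_neq0 HP _ _ _))) => ->.
  by rewrite -!scalemxAr [J' *m (J *m _)]mulmxA J'J mul1mx subrr.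
(* No representative reaches [h], so [h] is outside the orbit of [g] and [p h y] kills every
   generator. *)
rewrite big_pred0 //; suff -> : hatV (p h y) = 0 by rewrite mxtrace0.
apply: pi_mx_eq0 => f w v; rewrite pi_p; case: eqP => // _.
rewrite pi_eq0 ?scaler0 //; apply/eqP=> hw.
have [t Tt wt] := transversal_exists TP (y * w)%g.
by have := noT t; rewrite /= Tt hw wt eqxx.
Qed.

End InducedModule.
End Extension.

(** * Summing the traces over the terms of the Hopf square *)

Theorem theorem4p4
    (k : closedFieldType) (char_neq2 : 2%N \notin [pchar k])
    (G L : finGroupType)
    (char_ndvd : [pchar k]^'.-nat (#|{: G}| * #|{: L}|)%N)
    (act : L -> G -> G) (actP : acts_by_automorphisms act)
    (sigma : G -> L -> L -> k) (tau : G -> G -> L -> k)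
    (H : hopfAlgType k) (p : G -> L -> H)
    (HP : cocentral_extension act sigma tau p)
    (g : G)
    (A : falgType k) (e : L -> A)
    (AP : is_twisted_group_algebra act sigma g e)
    (n : nat) (V : {lrmorphism A -> 'M[k]_n}) (V_simple : simple_module V)
    (m : nat) (hatV : {lrmorphism H -> 'M[k]_m})
    (hatVP : is_induced_module (ext_restr p (stab act g))
               (pg_act act p g e V) hatV)
    (T : {set L})
    (TP : is_transversal T (lcosets (stab act g) [set: L]) [set: L]) :
  let chi := module_char V in
  schur_indicator (module_char hatV) =
    #|{: L}|%:R^-1 *
    \sum_(x in T) \sum_(z in transporter act g g^-1%g)
      (tau (act x g) (act x g^-1%g) (x * z * x^-1)%g
       * sigma (act x g) (x * z * x^-1)%g (x * z * x^-1)%g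
       * sigma (act x g) (x * z ^+ 2 * x^-1)%g x
       / sigma (act x g) x (z ^+ 2)%g)
      * chi (e (z ^+ 2)%g).
Proof.
have L0 : #|L|%:R != 0 :> k.
  move: char_ndvd; rewrite GRing.pcharf'_nat natrM mulf_eq0 negb_or.
  by case/andP.
have [pi [pi_surj pi_ker pi_act]] := hatVP.
rewrite /= /schur_indicator /module_char (hopf_square_integral1 actP HP L0).
rewrite linearZ [\tr _]linearZ /= linear_sum raddf_sum /=; congr (_ * _).
have trE x h : act x h == h^-1%g ->
    \tr (hatV ((tau h h^-1%g x * sigma h x x) *: p h (x ^+ 2)%g)) =
    \sum_(t in T | h == act t g) tau h h^-1%g x * sigma h x x *
      (sigma h (x ^+ 2)%g t / sigma h t ((x ^+ 2) ^ t)%g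
       * \tr (V (e ((x ^+ 2) ^ t)%g))).
  move=> /eqP xh; rewrite linearZ mxtraceZ.
  rewrite (trace_induced actP HP AP pi_surj pi_ker pi_act TP) ?mulr_sumr //.
  (* As [x] inverts [h], its square fixes [h], as [trace_induced] requires. *)
  by rewrite expgS expg1 (Defs.act_mul actP) xh (act_gV actP) xh invgK.
under eq_bigr => x _.
  rewrite linear_sum raddf_sum /=.
  rewrite (eq_bigr _ (trE x)) (exchange_big_dep [in T]) /=; last first.
    by move=> ? ? _ /andP[].
  over.
rewrite exchange_big /=; apply: eq_bigr => t Tt.
(* The substitution [x = t * z * t^-1] turns inversion of [act t g] by [x] into inversion of [g] by
   [z], which is [zt]. *)
rewrite (reindex_inj (conjg_inj t^-1%g)) /= [RHS]big_mkcond /=.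
apply: eq_bigr => z _.
have zt : (act (z ^ t^-1)%g (act t g) == (act t g)^-1%g) =
    (z \in transporter act g g^-1%g).
  rewrite inE conjgE invgK -(act_gV actP) !(Defs.act_mul actP) (act_invK actP).
  by rewrite (inj_eq (act_inj actP (x:=t))).
(* The inner sum over [h] is empty if [z] does not invert [g]; otherwise only [h = act t g]
   remains. *)
rewrite -zt; case: ifPn => ztg; last first.
  by apply: big1 => h /and3P[zh _ /eqP ht]; rewrite -ht zh in ztg.
rewrite (big_pred1 (act t g)) => [|h] /=; last first.
  by rewrite Tt /=; case: (h =P act t g) => [->|_]; rewrite ?ztg ?andbF.
have zE y : (y ^ t^-1 = t * y * t^-1)%g by rewrite conjgE invgK mulgA.
by rewrite -conjXg conjgKV !zE (act_gV actP) !mulrA.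
Qed.
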